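(* Let $Q\in\mathbb{R}^{d_1\times d_0}$ be any fixed projection matrix, and let $\Sigma_t$ be the follower's estimation error covariance of $x_*$ at time $t$, i.e. $\Sigma_t=\mathrm{Cov}(x_*-x_*^{(t)})$, when the implicit coordination scheme described in the context is run with this $Q$. Suppose there is a constant $\sigma>0$ such that $\Lambda_t(i)\ge\sigma$ for all $t$ and all $i\in\{1,\dots,d_0\}$. Then for any $t\ge 1$ it holds that $\Sigma_t\succeq\Sigma_{t+1}$. Moreover, if $\mathrm{rank}(B_1Q)=\mathrm{rank}(B_1)=d_0$, then $\Sigma_t\succ\Sigma_{t+1}$ and $$\mathrm{Tr}(\Sigma_t)\le\frac{1}{(1+\sigma\psi)^t}\,\mathrm{Tr}(\Sigma_0),$$ where $\psi=\min_i H(i)$.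
   Context: All matrices are real. $M\succeq N$ (resp. $M\succ N$) means $M-N$ is positive semi-definite (resp. positive definite); $M^{1/2}$ is the symmetric positive (semi-)definite square root. For a diagonal matrix $D$, $D(i)$ denotes its $i$-th diagonal entry. System. $x_{t+1}=Ax_t+B_1v_t+B_2q_t+w_t$, $t=0,1,2,\dots$, with $x_t\in\mathbb{R}^{d_0}$, leader input $v_t\in\mathbb{R}^{d_1}$, follower input $q_t\in\mathbb{R}^{d_2}$, and $w_t\sim\mathcal N(0,W)$ with $W\succ0$. The initial state is $x_0\sim\mathcal N(0,X_0)$, and the target state is $x_*\sim\mathcal N(0,\Sigma_0)$ with $\Sigma_0\succ0$. The variables $x_0$, $x_*$, $w_0,w_1,\dots$ are mutually independent. Put $B=[B_1\ B_2]$; $(A,B)$ is controllable. Both agents observe $x_t$ perfectly; only the leader knows $x_*$. The horizon length is an arbitrary $n$; statements about time $t$ (or $t+1$) refer to times not exceeding $n$. Gains. Let $F,F_n,G_1,G_2$ be positive semi-definite cost matrices and $G=\mathrm{diag}(G_1,G_2)$ (block diagonal). Set $\Phi_n=\bar D_n=F_n$, and for $0\le t\le n-1$ (inverses assumed to exist): $K_t=(G+B^\top\Phi_{t+1}B)^{-1}B^\top\Phi_{t+1}A$, $D_t=(G+B^\top\Phi_{t+1}B)^{-1}B^\top\bar D_{t+1}$ with $\bar D_t=(A-BK_t)^\top\bar D_{t+1}+F$, and $\Phi_t=F+A^\top\Phi_{t+1}A-A^\top\Phi_{t+1}B(G+B^\top\Phi_{t+1}B)^{-1}B^\top\Phi_{t+1}A$.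 Partition the rows as $K_t=\begin{bmatrix} K_t^l \\ K_t^f \end{bmatrix}$, $D_t=\begin{bmatrix} D_t^l \\ D_t^f \end{bmatrix}$ (first $d_1$ rows, last $d_2$ rows). Power matrices. $Q\in\mathbb{R}^{d_1\times d_0}$ is a fixed (deterministic) matrix, called the projection matrix. Since $(B_1Q)^\top W^{-1}B_1Q$ is positive semi-definite, write $(B_1Q)^\top W^{-1}B_1Q=UHU^\top$ with $U$ real unitary and $H$ diagonal. The deterministic positive definite matrices $S_t\in\mathbb{R}^{d_0\times d_0}$ have the form $S_t=U\Lambda_tU^\top$ with $\Lambda_t$ diagonal. Implicit coordination scheme (Algorithm 1). Initialize $e_0=x_*$, $x_*^{(0)}=0$. For $t=0,\dots,n-1$, with $\Sigma_t=\mathrm{Cov}(e_t)$: (1) $s_t=QS_t^{1/2}\Sigma_t^{-1/2}e_t$; (2) $c_t=[c_t^l,c_t^f]=D_tx_*^{(t)}$, i.e. $c_t^l=D_t^lx_*^{(t)}$ and $c_t^f=D_t^fx_*^{(t)}$; (3) apply $v_t=-K_t^lx_t+c_t^l+s_t$ and $q_t=-K_t^fx_t+c_t^f$, and observe $x_{t+1}$; (4) $y_t=x_{t+1}-(A-BK_t)x_t-Bc_t$ (so $y_t=B_1s_t+w_t$); (5) $\hat e_t=\mathbb{E}[e_t\mid y_t]=\Sigma_t^{1/2}S_t^{1/2}Q^\top B_1^\top(B_1QS_tQ^\top B_1^\top+W)^{-1}y_t$; (6) $e_{t+1}=e_t-\hat e_t$ and $x_*^{(t+1)}=x_*^{(t)}+\hat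 e_t$. Thus $x_*^{(t)}$ is the follower's estimate of $x_*$ at time $t$, and $e_t=x_*-x_*^{(t)}$ is its estimation error. *)

(* Defs.v *)
From HB Require Import structures.
From mathcomp Require Import all_boot all_order all_algebra.
From mathcomp Require Import all_classical all_reals all_analysis.
Set Implicit Arguments.
Unset Strict Implicit.
Unset Printing Implicit Defensive.

Import Order.TTheory GRing.Theory Num.Theory.
Local Open Scope classical_set_scope.
Local Open Scope ring_scope.

Definition psdmx (R : realType) (d : nat) (M : 'M[R]_d) : Prop :=
  M^T = M /\ forall a : 'cV[R]_d, 0 <= (a^T *m M *m a) 0 0.

Definition pdmx (R : realType) (d : nat) (M : 'M[R]_d) : Prop :=
  M^T = M /\ forall a : 'cV[R]_d, a != 0 -> 0 < (a^T *m M *m a) 0 0.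

Definition loewner_ge (R : realType) (d : nat) (M N : 'M[R]_d) : Prop :=
  psdmx (M - N).

Definition loewner_gt (R : realType) (d : nat) (M N : 'M[R]_d) : Prop :=
  pdmx (M - N).

(* [sqrtmx M] is M^{1/2}; the default value 0 is only reached when M is not
   positive semi-definite. *)
Definition sqrtmx (R : realType) (d : nat) (M : 'M[R]_d) : 'M[R]_d :=
  xget 0 [set N : 'M[R]_d | psdmx N /\ N *m N = M].

(* Diagonal matrices are [diag_mx H] with [H : 'rV_d]; [hd] provides the seed
   of the minimum, which would otherwise be empty for d = 0. *)
Definition min_entry (R : realType) (d : nat) (hd : (0 < d)%N)
    (H : 'rV[R]_d) : R :=
  \big[Num.min/H 0 (Ordinal hd)]_(i < d) H 0 i.

Definition controllable (R : realType) (d m : nat)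
    (A : 'M[R]_d) (B : 'M[R]_(d, m)) : Prop :=
  \rank (\mxrow_(k < d) (A ^+ k *m B)) = d.

Definition rv_coord (R : realType) (T : Type) (d : nat) (X : T -> 'cV[R]_d)
    (i : 'I_d) : T -> R :=
  fun o => X o i 0.

(* The Borel sets of R^d are generated by the coordinates, so this is the
   sigma-algebra generated by X. *)
Definition sigma_vec (R : realType) (T : Type) (d : nat)
    (X : T -> 'cV[R]_d) : set (set T) :=
  <<s [set E | exists (i : 'I_d) (V : set R),
         measurable V /\ E = rv_coord X i @^-1` V] >>.

Definition covmx (dp : measure_display) (T : measurableType dp) (R : realType)
    (P : probability T R) (d : nat) (X : T -> 'cV[R]_d) : 'M[R]_d :=
  \matrix_(i, j) fine (covariance P (rv_coord X i) (rv_coord X j)).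

(* The law N(0, v) on the line. The case v = 0 is separate because the
   library's [normal_prob m 0] is the uniform law on [0, 1]. *)
Definition normal_law (R : realType) (v : R) (V : set R) : \bar R :=
  if v == 0 then \d_(0 : R) V else normal_prob 0 (Num.sqrt v) V.

(* X ~ N(0, S): every linear form a^T X has law N(0, a^T S a). This covers
   singular S. *)
Definition gaussian (dp : measure_display) (T : measurableType dp)
    (R : realType) (P : probability T R) (d : nat)
    (X : T -> 'cV[R]_d) (S : 'M[R]_d) : Prop :=
  [/\ psdmx S,
      forall i : 'I_d, measurable_fun setT (rv_coord X i)
    & forall (a : 'cV[R]_d) (V : set R), measurable V ->
        P [set o | V ((a^T *m X o) 0 0)] =
        normal_law ((a^T *m S *m a) 0 0) V].

Definition mutually_independent (dp : measure_display)
    (T : measurableType dp) (R : realType) (P : probability T R)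
    (I : choiceType) (d : nat) (X : I -> T -> 'cV[R]_d) : Prop :=
  forall (J : seq I) (E : I -> set T), uniq J ->
    (forall i, i \in J -> sigma_vec (X i) (E i)) ->
    P (\bigcap_(i in [set` J]) E i) = (\prod_(i <- J) P (E i))%E.

(* Z is a version of E[X | Y]; conditional expectations are determined only
   almost surely, hence a relation. *)
Definition is_cond_exp (dp : measure_display) (T : measurableType dp)
    (R : realType) (P : probability T R) (d m : nat)
    (X : T -> 'cV[R]_d) (Y : T -> 'cV[R]_m) (Z : T -> 'cV[R]_d) : Prop :=
  forall i : 'I_d,
    [/\ P.-integrable setT (EFin \o rv_coord X i),
        P.-integrable setT (EFin \o rv_coord Z i),
        forall V : set R, measurable V -> sigma_vec Y (rv_coord Z i @^-1` V)
      & forall E : set T, sigma_vec Y E ->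
          (\int[P]_(o in E) (rv_coord Z i o)%:E =
           \int[P]_(o in E) (rv_coord X i o)%:E)%E].

Definition primitives (V : Type) (x0 xs : V) (w : nat -> V) (k : nat) : V :=
  match k with
  | 0 => x0
  | 1 => xs
  | k'.+2 => w k'
  end.

Record gains (R : realType) (n d m : nat)
    (A : 'M[R]_d) (B : 'M[R]_(d, m)) (F Fn : 'M[R]_d) (G : 'M[R]_m)
    (Phi Dbar : nat -> 'M[R]_d) (K D : nat -> 'M[R]_(m, d)) : Prop := Gains {
  gains_Phi_n : Phi n = Fn;
  gains_Dbar_n : Dbar n = Fn;
  gains_unit : forall t, (t < n)%N -> G + B^T *m Phi t.+1 *m B \in unitmx;
  gains_K : forall t, (t < n)%N ->
    K t = invmx (G + B^T *m Phi t.+1 *m B) *m B^T *m Phi t.+1 *m A;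
  gains_D : forall t, (t < n)%N ->
    D t = invmx (G + B^T *m Phi t.+1 *m B) *m B^T *m Dbar t.+1;
  gains_Dbar : forall t, (t < n)%N ->
    Dbar t = (A - B *m K t)^T *m Dbar t.+1 + F;
  gains_Phi : forall t, (t < n)%N ->
    Phi t = F + A^T *m Phi t.+1 *m A
            - A^T *m Phi t.+1 *m B *m invmx (G + B^T *m Phi t.+1 *m B)
              *m B^T *m Phi t.+1 *m A }.

(* One closed-loop run over the horizon n: [xhat t] is the follower's estimate
   x_*^(t) of the target [xs], and e_t = xs - xhat t is its error. The estimate
   \hat e_t of e_t is both a version of E[e_t | y_t] and the linear Gaussian
   estimator given by the explicit formula. *)
Record implicit_coordination (dp : measure_display) (T : measurableType dp)
    (R : realType) (P : probability T R) (n d0 d1 d2 : nat)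
    (A : 'M[R]_d0) (B1 : 'M[R]_(d0, d1)) (B2 : 'M[R]_(d0, d2)) (W : 'M[R]_d0)
    (K D : nat -> 'M[R]_(d1 + d2, d0))
    (Q : 'M[R]_(d1, d0)) (S : nat -> 'M[R]_d0)
    (x0 xs : T -> 'cV[R]_d0) (w : nat -> T -> 'cV[R]_d0)
    (x : nat -> T -> 'cV[R]_d0)
    (v : nat -> T -> 'cV[R]_d1) (q : nat -> T -> 'cV[R]_d2)
    (s : nat -> T -> 'cV[R]_d1) (c : nat -> T -> 'cV[R]_(d1 + d2))
    (y e ehat xhat : nat -> T -> 'cV[R]_d0) : Prop := ImplicitCoordination {
  ic_x0 : forall o, x 0%N o = x0 o;
  ic_x : forall t o, (t < n)%N ->
    x t.+1 o = A *m x t o + B1 *m v t o + B2 *m q t o + w t o;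
  ic_e0 : forall o, e 0%N o = xs o;
  ic_xhat0 : forall o, xhat 0%N o = 0;
  ic_s : forall t o, (t < n)%N ->
    s t o = Q *m sqrtmx (S t) *m invmx (sqrtmx (covmx P (e t))) *m e t o;
  ic_c : forall t o, (t < n)%N -> c t o = D t *m xhat t o;
  ic_v : forall t o, (t < n)%N ->
    v t o = - (usubmx (K t) *m x t o) + usubmx (c t o) + s t o;
  ic_q : forall t o, (t < n)%N ->
    q t o = - (dsubmx (K t) *m x t o) + dsubmx (c t o);
  ic_y : forall t o, (t < n)%N ->
    y t o = x t.+1 o - (A - row_mx B1 B2 *m K t) *m x t o
            - row_mx B1 B2 *m c t o;
  ic_ehat_cond : forall t, (t < n)%N -> is_cond_exp P (e t) (y t) (ehat t);
  ic_ehat : forall t o, (t < n)%N ->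
    ehat t o = sqrtmx (covmx P (e t)) *m sqrtmx (S t) *m Q^T *m B1^T
               *m invmx (B1 *m Q *m S t *m Q^T *m B1^T + W) *m y t o;
  ic_e : forall t o, (t < n)%N -> e t.+1 o = e t o - ehat t o;
  ic_xhat : forall t o, (t < n)%N -> xhat t.+1 o = xhat t o + ehat t o }.

(* Main.v *)
(* With N = B1 Q S_t^{1/2} and V = N N^T + W, the error obeys the linear
   recursion e_{t+1} = M e_t - L w_t, where L = Sigma_t^{1/2} N^T V^{-1} and
   M = 1 - L N Sigma_t^{-1/2}. Since e_t depends only on x_* and
   w_0, ..., w_{t-1}, it is uncorrelated with w_t, whence
   Sigma_{t+1} = Sigma_t^{1/2} J Sigma_t^{1/2} with
   J = 1 - N^T V^{-1} N = (1 + N^T W^{-1} N)^{-1} (Woodbury).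
   The difference Sigma_t - Sigma_{t+1} is a congruence of V^{-1}. Moreover
   N^T W^{-1} N >= psi S_t >= sigma psi as quadratic forms, so
   J <= 1 / (1 + sigma psi), which gives the trace bound.
   Two facts about Gaussian vectors are needed: X ~ N(0, S) has covariance S,
   and independent square-integrable variables are uncorrelated. *)
Require Import Defs.
From HB Require Import structures.
From mathcomp Require Import all_boot all_order all_algebra.
From mathcomp Require Import all_classical all_reals all_analysis.
From mathcomp Require Import measurable_realfun complex ring lra.
Set Implicit Arguments.
Unset Strict Implicit.
Unset Printing Implicit Defensive.

Import Order.TTheory GRing.Theory Num.Theory.
Import numFieldNormedType.Exports.
Local Open Scope classical_set_scope.
Local Open Scope ring_scope.

(** * Positive semi-definite matrices and their square roots *)

Section PositiveSemidefinite.
Variable R : realType.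

Lemma dotmx_sum d (a : 'cV[R]_d) : (a^T *m a) 0 0 = \sum_i a i 0 ^+ 2.
Proof. by rewrite mxE; apply: eq_bigr => i _; rewrite mxE expr2. Qed.

Lemma dotmx_ge0 d (a : 'cV[R]_d) : 0 <= (a^T *m a) 0 0.
Proof. by rewrite dotmx_sum sumr_ge0// => i _; rewrite sqr_ge0. Qed.

Lemma dotmx_gt0 d (a : 'cV[R]_d) : a != 0 -> 0 < (a^T *m a) 0 0.
Proof.
move=> a0; rewrite lt0r dotmx_ge0 andbT; apply: contra a0 => /eqP a2.
apply/eqP/matrixP => i j; rewrite ord1 mxE; apply/eqP.
move: a2; rewrite dotmx_sum => /psumr_eq0P ai.
by rewrite -sqrf_eq0 ai// => k _; rewrite sqr_ge0.
Qed.

Lemma pd_psd d (M : 'M[R]_d) : pdmx M -> psdmx M.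
Proof.
move=> [sM pM]; split=> // a; have [->|a0] := eqVneq a 0.
  by rewrite mulmx0 mxE.
exact/ltW/pM.
Qed.

Lemma psd_congr d k (M : 'M[R]_d) (B : 'M[R]_(d, k)) :
  psdmx M -> psdmx (B^T *m M *m B).
Proof.
move=> [sM pM]; split; first by rewrite !trmx_mul trmxK sM mulmxA.
by move=> a; have := pM (B *m a); rewrite trmx_mul !mulmxA.
Qed.

Lemma pd_congr d (M : 'M[R]_d) (B : 'M[R]_d) :
  B \in unitmx -> pdmx M -> pdmx (B^T *m M *m B).
Proof.
move=> uB pM; have [sB _] := psd_congr B (pd_psd pM); case: pM => [sM pM].
split=> // a a0; have := pM (B *m a); rewrite trmx_mul !mulmxA; apply.
by apply: contra a0 => /eqP Ba0; rewrite -(mulKmx uB a) Ba0 mulmx0.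
Qed.

Lemma pd_add d (M N : 'M[R]_d) : psdmx M -> pdmx N -> pdmx (M + N).
Proof.
move=> [sM pM] [sN pN]; split; first by rewrite linearD /= sM sN.
by move=> a a0; rewrite mulmxDr mulmxDl mxE ltr_wpDl ?pN.
Qed.

Lemma pd1 d : pdmx (1%:M : 'M[R]_d).
Proof. by split=> [|a a0]; rewrite ?trmx1// mulmx1 dotmx_gt0. Qed.

Lemma pd_unit d (M : 'M[R]_d) : pdmx M -> M \in unitmx.
Proof.
move=> [sM pM]; rewrite -row_free_unit -kermx_eq0.
apply/negPn/negP => /rowV0Pn[v /sub_kermxP vM v0].
have := pM v^T; rewrite trmx_eq0 trmxK vM mul0mx mxE ltxx => H.
by have := H v0.
Qed.

Lemma trmx_invmx_sym d (M : 'M[R]_d) : M^T = M -> (invmx M)^T = invmx M.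
Proof. by move=> sM; rewrite trmx_inv sM. Qed.

(** The inverse is the congruence of [M] by the symmetric matrix [invmx M]. *)
Lemma pd_inv d (M : 'M[R]_d) : pdmx M -> pdmx (invmx M).
Proof.
move=> pM; have uM := pd_unit pM; have := pd_congr (B := invmx M) _ pM.
by rewrite unitmx_inv trmx_invmx_sym ?(proj1 pM)// mulVmx// mul1mx; apply.
Qed.

Lemma psd_gram d k (B : 'M[R]_(k, d)) : psdmx (B^T *m B).
Proof. by rewrite -[X in X *m _]mulmx1; exact/psd_congr/pd_psd/pd1. Qed.

(** A new node is met by adding a multiple of the product of the ['X - b%:P] over the earlier nodes
    [b], which leaves the earlier values unchanged. Interpolation on the spectrum is what turns a
    real function into a function of a symmetric matrix. *)
Lemma interpolation (F : fieldType) (s : seq F) (f : F -> F) :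
  exists p : {poly F}, forall x, x \in s -> p.[x] = f x.
Proof.
elim: s => [|a s [p ps]]; first by exists 0.
have [as_|as_] := boolP (a \in s).
  by exists p => x; rewrite inE => /predU1P[->|]; exact: ps.
pose q := \prod_(b <- s) ('X - b%:P).
have qa : q.[a] != 0.
  by rewrite -rootE root_prod_XsubC.
exists (p + ((f a - p.[a]) / q.[a]) *: q) => x.
rewrite inE hornerD hornerZ => /predU1P[->|xs]; first by rewrite divfK// addrC subrK.
rewrite ps//; have /rootP -> : root q x by rewrite root_prod_XsubC.
by rewrite mulr0 addr0.
Qed.

Lemma horner_mx_sym d (M : 'M[R]_d.+1) (p : {poly R}) :
  M^T = M -> (horner_mx M p)^T = horner_mx M p.
Proof.
move=> sM; elim/poly_ind: p => [|p c ih]; first by rewrite rmorph0 trmx0.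
rewrite rmorphD rmorphM /= horner_mx_X horner_mx_C linearD /= tr_scalar_mx.
by rewrite trmx_mul ih sM; congr (_ + _); apply/esym/comm_horner_mx.
Qed.

(* Over R[i] the matrix is diagonalised by a unitary matrix, with the real
   eigenvalues of M; hence p(M) = 0 for a real polynomial p vanishing on them. *)
Lemma sym_horner_mx_eq0 d (M : 'M[R]_d.+1) (sM : M^T = M) :
  exists s : seq R, (forall r, r \in s -> eigenvalue M r) /\
    forall p : {poly R}, (forall r, r \in s -> p.[r] = 0) -> horner_mx M p = 0.
Proof.
pose f : {rmorphism R -> R[i]} := real_complex R.
pose Mc := map_mx f M.
have hM : Mc \is hermsymmx.
  apply: realsym_hermsym.
    apply/is_hermitianmxP; rewrite expr0 scale1r map_mx_id//.
    by apply/matrixP => i j; rewrite !mxE -[in RHS]sM mxE.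
  by apply/mxOverP => i j; rewrite mxE; apply/complex_realP; exists (M i j).
have /orthomx_spectralP := hermitian_normalmx hM.
have := hermitian_spectral_diag_real hM.
have := spectral_unit Mc.
set V := spectralmx Mc; set D := spectral_diag Mc => uV rD MV.
have /choice[g gD] : forall i, exists r, D 0 i = f r.
  move=> i; by apply/complex_realP; apply: (mxOverP rD).
exists [seq g i | i <- enum 'I_d.+1]; split.
  move=> _ /mapP[i _ ->]; rewrite eigenvalue_root_char.
  rewrite -(fmorph_root f) map_char_poly -/Mc.
  rewrite -eigenvalue_root_char; apply/eigenvalueP.
  (* The rows of [V] are left eigenvectors, and an invertible [V] has no zero row. *)
  exists (row i V); last first.
    apply: contraL uV => /eqP Vi; rewrite -row_free_unit.
    by apply/row_freePn; exists i; rewrite Vi sub0mx.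
  rewrite {1}MV -row_mul !mulmxA mulmxV// mul1mx row_mul row_diag_mx gD.
  by rewrite -scalemxAl -rowE.
move=> p p0; apply: (@map_mx_inj _ _ f); rewrite map_mx0 map_horner_mx -/Mc MV.
rewrite horner_mx_uconjC// horner_mx_diag (_ : map_mx _ _ = 0).
  by rewrite linear0 mulmx0 mul0mx.
apply/matrixP => i j; rewrite !mxE ord1 gD horner_map p0 ?rmorph0//.
by apply/mapP; exists j; rewrite ?mem_enum.
Qed.

Lemma psd_eigenvalue_ge0 d (M : 'M[R]_d) r : psdmx M -> eigenvalue M r -> 0 <= r.
Proof.
move=> [_ pM] /eigenvalueP[v vM v0]; have := pM v^T.
rewrite trmxK vM -scalemxAl mxE -{1}[v]trmxK pmulr_lge0// dotmx_gt0//.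
by rewrite trmx_eq0.
Qed.

(* A polynomial g with g(r) = r^(1/4) on the spectrum makes the square root
   g(M) * g(M) visibly positive semi-definite. *)
Lemma psd_sqrt d (M : 'M[R]_d) : psdmx M ->
  exists N : 'M[R]_d, psdmx N /\ N *m N = M.
Proof.
(* Polynomials in a matrix are evaluated in size [d.+1]; in size zero all matrices coincide. *)
case: d M => [|d] M pM.
  by exists M; split=> //; rewrite [LHS]flatmx0 [RHS]flatmx0.
have [s [sM s0]] := sym_horner_mx_eq0 (proj1 pM).
have [g gs] := interpolation s (fun r => Num.sqrt (Num.sqrt r)).
have gsym := horner_mx_sym g (proj1 pM).
exists (horner_mx M (g * g)); split.
  by rewrite rmorphM /= -{1}gsym; exact: psd_gram.
(* The polynomial [g ^+ 4 - 'X] vanishes on the spectrum, where the eigenvalues are nonnegative and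
   the nested roots are genuine. *)
have /subr0_eq : horner_mx M (g * g) *m horner_mx M (g * g) - M = 0.
  rewrite -{3}[M]horner_mx_X -[_ *m _]rmorphM -rmorphB /=; apply: s0 => r rs.
  have r0 : 0 <= r := psd_eigenvalue_ge0 pM (sM _ rs).
  by rewrite hornerD hornerN hornerX !hornerM gs// -!expr2 !sqr_sqrtr ?subrr ?sqrtr_ge0.
by [].
Qed.

(** The existence of a root rules out the default value of [xget]. *)
Lemma sqrtmxP d (M : 'M[R]_d) : psdmx M ->
  psdmx (sqrtmx M) /\ sqrtmx M *m sqrtmx M = M.
Proof.
move=> pM; rewrite /sqrtmx; have [N PN] := psd_sqrt pM.
by case: xgetP => [? _ //|/(_ N)].
Qed.

Lemma sqrtmx_unit d (M : 'M[R]_d) : pdmx M -> sqrtmx M \in unitmx.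
Proof.
move=> pM; have [_ M2] := sqrtmxP (pd_psd pM); have := pd_unit pM.
by rewrite -{1}M2 unitmx_mul => /andP[].
Qed.

End PositiveSemidefinite.

(** * The covariance update *)

Section ErrorCovarianceStep.
Variable R : realType.

Lemma min_entry_le d (hd : (0 < d)%N) (H : 'rV[R]_d) i : min_entry hd H <= H 0 i.
Proof. exact: bigmin_le. Qed.

Lemma min_entry_ge0 d (hd : (0 < d)%N) (H : 'rV[R]_d) :
  (forall i, 0 <= H 0 i) -> 0 <= min_entry hd H.
Proof. by move=> H0; rewrite /min_entry; apply: le_bigmin. Qed.

Lemma diag_form d (H : 'rV[R]_d) (a : 'cV[R]_d) :
  (a^T *m diag_mx H *m a) 0 0 = \sum_i H 0 i * a i 0 ^+ 2.
Proof.
by rewrite mxE; apply: eq_bigr => i _; rewrite mul_mx_diag !mxE expr2 mulrAC mulrC mulrA.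
Qed.

Lemma diag_form_ge d (H : 'rV[R]_d) (a : 'cV[R]_d) (c : R) :
  (forall i, c <= H 0 i) -> c * (a^T *m a) 0 0 <= (a^T *m diag_mx H *m a) 0 0.
Proof.
move=> cH; rewrite diag_form dotmx_sum mulr_sumr ler_sum// => i _.
by rewrite ler_wpM2r ?sqr_ge0.
Qed.

(** The vector [U^T *m a] has the same norm as [a], which reduces the bound to the diagonal case. *)
Lemma orthogonal_diag_form_ge d (U : 'M[R]_d) (H : 'rV[R]_d) (a : 'cV[R]_d) (c : R) :
  U *m U^T = 1%:M -> (forall i, c <= H 0 i) ->
  c * (a^T *m a) 0 0 <= (a^T *m (U *m diag_mx H *m U^T) *m a) 0 0.
Proof.
move=> UU cH.
have -> : a^T *m a = (U^T *m a)^T *m (U^T *m a).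
  by rewrite trmx_mul trmxK mulmxA -(mulmxA a^T) UU mulmx1.
have -> : a^T *m (U *m diag_mx H *m U^T) *m a =
          (U^T *m a)^T *m diag_mx H *m (U^T *m a).
  by rewrite trmx_mul trmxK !mulmxA.
exact: diag_form_ge.
Qed.

Lemma form_delta d (M : 'M[R]_d) (i : 'I_d) :
  let a : 'cV[R]_d := delta_mx i 0 in (a^T *m M *m a) 0 0 = M i i.
Proof. by rewrite /= trmx_delta -rowE -colE !mxE. Qed.

(* Woodbury *)
Lemma inv_innovation d m (N : 'M[R]_(m, d)) (W : 'M[R]_m) :
  W \in unitmx -> N *m N^T + W \in unitmx ->
  (1%:M + N^T *m invmx W *m N) *m
  (1%:M - N^T *m invmx (N *m N^T + W) *m N) = 1%:M.
Proof.
move=> uW; set V := N *m N^T + W => uV.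
have NV : N^T *m invmx W *m N *m (N^T *m invmx V *m N) =
          N^T *m invmx W *m N - N^T *m invmx V *m N.
  (* Writing the inner factor [N *m N^T] as [V - W] lets it cancel against the inverse on either
     side. *)
  have -> : N^T *m invmx W *m N *m (N^T *m invmx V *m N) =
            N^T *m invmx W *m (V - W) *m invmx V *m N.
    by rewrite /V addrK !mulmxA.
  by rewrite mulmxBr mulmxKV// !mulmxBl -!mulmxA mulKVmx// mulmxA.
by rewrite mulmxBr mulmx1 mulmxDl mul1mx NV [X in _ - X]addrC subrK addrK.
Qed.

(** Put [J = invmx (1 + X)], [a = J b] and [k = 1 + c]. The hypothesis gives
    [k |a|^2 <= a^T (1 + X) a = b^T J b]; inserting this into the expansion of [|b - k a|^2 >= 0]
    leaves [k b^T J b <= |b|^2]. *)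
Lemma psd_sub_inv_form d (X : 'M[R]_d) (c : R) (b : 'cV[R]_d) :
  psdmx X -> (forall a : 'cV[R]_d, c * (a^T *m a) 0 0 <= (a^T *m X *m a) 0 0) ->
  0 <= c ->
  (1 + c) * (b^T *m invmx (1%:M + X) *m b) 0 0 <= (b^T *m b) 0 0.
Proof.
move=> pX cX c0; have pC := pd_add pX (@pd1 R d); rewrite addrC in pC.
have uC := pd_unit pC; have sJ := trmx_invmx_sym (proj1 pC).
set J := invmx _ in sJ *; set k := 1 + c.
pose a := J *m b.
have ab : (a^T *m b) 0 0 = (b^T *m J *m b) 0 0 by rewrite trmx_mul sJ.
have ba : (b^T *m a) 0 0 = (b^T *m J *m b) 0 0 by rewrite mulmxA.
have Ca : a^T *m (1%:M + X) *m a = a^T *m b by rewrite -mulmxA mulKVmx.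
have le_ab : k * (a^T *m a) 0 0 <= (a^T *m b) 0 0.
  by rewrite -Ca mulmxDr mulmxDl mulmx1 [X in _ <= X]mxE /k mulrDl mul1r lerD2l.
have : 0 <= ((b - k *: a)^T *m (b - k *: a)) 0 0 by exact: dotmx_ge0.
have -> : ((b - k *: a)^T *m (b - k *: a)) 0 0 =
    (b^T *m b) 0 0 - k * (b^T *m J *m b) 0 0 - k * (b^T *m J *m b) 0 0
    + k * (k * (a^T *m a) 0 0).
  have subE (A B : 'M[R]_1) : (A - B) 0 0 = A 0 0 - B 0 0 by rewrite !mxE.
  have scaleE (A : 'M[R]_1) (r : R) : (r *: A) 0 0 = r * A 0 0 by rewrite mxE.
  have -> : (b - k *: a)^T = b^T - k *: a^T by apply/matrixP => i j; rewrite !mxE.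
  rewrite mulmxBl !mulmxBr -!scalemxAl -!scalemxAr !(subE, scaleE) ba ab.
  by ring.
rewrite ab in le_ab.
have := ler_wpM2l (_ : 0 <= k) le_ab; rewrite addr_ge0// => /(_ isT).
lra.
Qed.

Variables (d m : nat) (B : 'M[R]_(m, d)) (W : 'M[R]_m) (S : 'M[R]_d).
Hypotheses (pW : pdmx W) (pS : pdmx S).

Let N := B *m sqrtmx S.
Let X := N^T *m invmx W *m N.

(** With [B1 *m Q] for [B], this is the covariance V of the observation [y t]. The factor J below is
    the error covariance after the observation, in coordinates where the one before it is the
    identity. *)
Definition innovation_cov := N *m N^T + W.
Definition posterior_factor := 1%:M - N^T *m invmx innovation_cov *m N.

Lemma innovation_cov_pd : pdmx innovation_cov.
Proof. by apply: pd_add => //; rewrite -{1}[N]trmxK; exact: psd_gram. Qed.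

Let X_psd : psdmx X.
Proof. exact/psd_congr/pd_psd/pd_inv. Qed.

Lemma posterior_factorE : posterior_factor = invmx (1%:M + X).
Proof.
have uC : 1%:M + X \in unitmx.
  by apply: pd_unit; rewrite addrC; apply: pd_add X_psd (@pd1 R d).
have := inv_innovation (pd_unit pW) (pd_unit innovation_cov_pd).
by move=> /(congr1 (mulmx (invmx (1%:M + X)))); rewrite mulKmx// mulmx1.
Qed.

Lemma posterior_factor_pd : pdmx posterior_factor.
Proof.
rewrite posterior_factorE; apply: pd_inv; rewrite addrC.
exact: pd_add X_psd (@pd1 R d).
Qed.

(** At [a], the form of [X] is the form of [U H U^T] at [sqrtmx S *m a], hence at least
    [psi a^T S a], hence at least [sigma psi |a|^2]. Then [psd_sub_inv_form] applies with
    [c = sigma * psi]. *)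
Lemma posterior_factor_le (U : 'M[R]_d) (H L : 'rV[R]_d) (sigma psi : R)
    (b : 'cV[R]_d) :
  U *m U^T = 1%:M -> B^T *m invmx W *m B = U *m diag_mx H *m U^T ->
  S = U *m diag_mx L *m U^T ->
  0 <= sigma -> (forall i, sigma <= L 0 i) ->
  0 <= psi -> (forall i, psi <= H 0 i) ->
  (1 + sigma * psi) * (b^T *m posterior_factor *m b) 0 0 <= (b^T *m b) 0 0.
Proof.
move=> UU BH SL sigma0 sigmaL psi0 psiH; rewrite posterior_factorE.
have [[sS _] S2] := sqrtmxP (pd_psd pS).
apply: psd_sub_inv_form => //; last exact: mulr_ge0.
move=> a; rewrite /X /N trmx_mul sS.
have -> : a^T *m (sqrtmx S *m B^T *m invmx W *m (B *m sqrtmx S)) *m a =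
    (sqrtmx S *m a)^T *m (U *m diag_mx H *m U^T) *m (sqrtmx S *m a).
  by rewrite -BH trmx_mul sS !mulmxA.
apply: le_trans (orthogonal_diag_form_ge (sqrtmx S *m a) UU psiH).
rewrite (mulrC sigma) -mulrA; apply: ler_wpM2l => //.
have -> : (sqrtmx S *m a)^T *m (sqrtmx S *m a) = a^T *m S *m a.
  by rewrite trmx_mul sS -[in RHS]S2 !mulmxA.
by rewrite {1}SL; exact: orthogonal_diag_form_ge.
Qed.

Variable Sig : 'M[R]_d.
Hypothesis pSig : pdmx Sig.

Definition posterior_cov := sqrtmx Sig *m posterior_factor *m sqrtmx Sig.

Lemma posterior_cov_pd : pdmx posterior_cov.
Proof.
have [[s _] _] := sqrtmxP (pd_psd pSig).
by rewrite /posterior_cov -{1}s; apply: pd_congr posterior_factor_pd; exact: sqrtmx_unit.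
Qed.

(* Joseph form of the Kalman covariance update. *)
Lemma posterior_covE :
  let L := sqrtmx Sig *m N^T *m invmx innovation_cov in
  let M := 1%:M - L *m N *m invmx (sqrtmx Sig) in
  M *m Sig *m M^T + L *m W *m L^T = posterior_cov.
Proof.
move=> L M; have [[sG _] G2] := sqrtmxP (pd_psd pSig).
have uG := sqrtmx_unit pSig; have uV := pd_unit innovation_cov_pd.
have sV := trmx_invmx_sym (proj1 innovation_cov_pd).
set V := innovation_cov in uV sV L M *; set G := sqrtmx Sig in sG G2 uG L M *.
set J := posterior_factor.
have sJ : J^T = J by exact: (proj1 posterior_factor_pd).
have MG : M *m G = G *m J.
  by rewrite /M mulmxBl mul1mx mulmxKV// /J /posterior_factor mulmxBr mulmx1 !mulmxA.
have -> : M *m Sig *m M^T = G *m (J *m J) *m G.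
  have -> : M *m Sig *m M^T = (M *m G) *m (M *m G)^T.
    by rewrite trmx_mul sG -[in LHS]G2 !mulmxA.
  by rewrite MG trmx_mul sG sJ !mulmxA.
have -> : L *m W *m L^T = G *m (N^T *m invmx V *m W *m invmx V *m N) *m G.
  by rewrite /L (trmx_mul (G *m N^T)) (trmx_mul G) trmxK sV sG !mulmxA.
rewrite /posterior_cov -/G -/J -mulmxDl -mulmxDr; congr (_ *m _ *m _).
(* As [W = V - N N^T], the noise term is [C - C^2]; with [J = 1 - C] the total [J^2 + C - C^2] is
   [J]. *)
pose C := N^T *m invmx V *m N.
have -> : N^T *m invmx V *m W *m invmx V *m N = C - C *m C.
  have -> : W = V - N *m N^T by rewrite /V /innovation_cov addrC addKr.
  by rewrite mulmxBr mulmxKV// !mulmxBl /C !mulmxA.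
have -> : J = 1%:M - C by [].
by rewrite mulmxBr mulmx1 mulmxBl mul1mx subrK.
Qed.

(** As a congruence of the inverse of V, the decrease is always positive semi-definite, and definite
    once [N *m sqrtmx Sig] is invertible. *)
Lemma sub_posterior_cov : Sig - posterior_cov =
  (N *m sqrtmx Sig)^T *m invmx innovation_cov *m (N *m sqrtmx Sig).
Proof.
have [[s _] s2] := sqrtmxP (pd_psd pSig).
rewrite /posterior_cov /posterior_factor mulmxBr mulmxBl mulmx1 s2 opprB addrC subrK.
by rewrite (trmx_mul N) s !mulmxA.
Qed.

Lemma sub_posterior_cov_psd : psdmx (Sig - posterior_cov).
Proof. rewrite sub_posterior_cov; exact/psd_congr/pd_psd/pd_inv/innovation_cov_pd. Qed.

(** The trace is bounded entry by entry: the hypothesis at the [i]-th column of [sqrtmx Sig]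
    compares the [i]-th diagonal entries. *)
Lemma tr_posterior_cov_le (k : R) :
  (forall b : 'cV[R]_d,
     k * (b^T *m posterior_factor *m b) 0 0 <= (b^T *m b) 0 0) ->
  k * \tr posterior_cov <= \tr Sig.
Proof.
move=> kJ; have [[s _] s2] := sqrtmxP (pd_psd pSig).
rewrite -[in X in _ <= X]s2 /posterior_cov /mxtrace mulr_sumr; apply: ler_sum => i _.
rewrite -[X in k * X <= _]form_delta -[X in _ <= X]form_delta /=.
by have := kJ (sqrtmx Sig *m delta_mx i 0); rewrite trmx_mul s !mulmxA.
Qed.

End ErrorCovarianceStep.

Lemma sub_posterior_cov_pd (R : realType) d (B W S Sig : 'M[R]_d) :
  pdmx W -> pdmx S -> pdmx Sig -> B \in unitmx ->
  pdmx (Sig - posterior_cov B W S Sig).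
Proof.
move=> pW pS pSig uB; rewrite sub_posterior_cov//; apply: pd_congr.
  by rewrite !unitmx_mul uB !sqrtmx_unit.
exact/pd_inv/innovation_cov_pd.
Qed.

(** * The second moment of the normal law *)

Section NormalSecondMoment.
Variables (R : realType) (s : R).
Hypothesis s0 : 0 < s.
Local Notation mu := (@lebesgue_measure R).

Let s_neq0 : s != 0. Proof. by rewrite gt_eqF. Qed.

Let g : R -> R := normal_pdf 0 s.

Let gE x : g x = normal_peak s * expR (- (2 * s ^+ 2)^-1 * x ^+ 2).
Proof.
rewrite /g normal_pdfE// /normal_fun subr0; congr (_ * expR _).
by rewrite mulNr mulrC -mulNr -mulr_natl.
Qed.

Let derive_g (x : R) : is_derive x 1 g (- (s ^+ 2)^-1 * x * g x).
Proof.
pose k : R := - (2 * s ^+ 2)^-1.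
have -> : g = normal_peak s \*: (expR \o (k \*: ((id : R -> R) ^+ 2))).
  by apply/funext => y; rewrite gE.
apply: is_derive_eq.
set E := expR _.
transitivity (normal_peak s * (E * (k * (2 * x ^+ 1 * 1)))) => //.
transitivity (- s ^- 2 * x * (normal_peak s * E)) => //.
rewrite /k; field; exact: s_neq0.
Qed.

Let cg : continuous g. Proof. exact: continuous_normal_pdf. Qed.

(** From [z <= 1 + z <= e^z] at [z = x^2 / (2 s^2)]. This decay suffices for [x * g x] to tend to
    0. *)
Let g_le x : 0 < x -> g x <= normal_peak s * ((2 * s ^+ 2) / x ^+ 2).
Proof.
move=> x0; rewrite gE ler_wpM2l ?normal_peak_ge0// mulNr expRN -[leRHS]invrK.
rewrite lef_pV2 ?posrE ?expR_gt0 ?invr_gt0 ?divr_gt0 ?mulr_gt0 ?exprn_gt0//.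
by rewrite invf_div mulrC; apply: le_trans (expR_ge1Dx _); rewrite lerDr.
Qed.

Let cvg_xg : x * g x @[x --> +oo] --> (0 : R).
Proof.
pose c := normal_peak s * (2 * s ^+ 2).
have cvg0 : c * x^-1 @[x --> +oo] --> (0 : R).
  rewrite -[X in _ --> X](mulr0 c); apply: cvgMr.
  by apply/gtr0_cvgV0; [exact: nbhs_pinfty_gt|exact: cvg_id].
apply: (squeeze_cvgr _ (cvg_cst 0) cvg0).
near=> x; have x0 : 0 < x by near: x; exact: nbhs_pinfty_gt.
apply/andP; split; first by rewrite mulr_ge0 ?normal_pdf_ge0 ?(ltW x0).
apply: (le_trans (ler_wpM2l (ltW x0) (g_le x0))).
rewrite le_eqVlt; apply/orP; left; apply/eqP; rewrite /c; field.
by rewrite gt_eqF.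
Unshelve. all: by end_near. Qed.

(* The improper fundamental theorem of calculus needs an integrand of constant
   sign, while the derivative (x^2 - v) g of - v x g changes sign at s; adding
   h x = c e^(-x) with this constant c makes it nonnegative on [0, +oo[. *)
Let v := s ^+ 2.
Let c := v * normal_peak s * expR s.

Let c_ge0 : 0 <= c.
Proof.
by rewrite mulr_ge0 ?expR_ge0// mulr_ge0 ?normal_peak_ge0// sqr_ge0.
Qed.

Let h (x : R) := c * expR (- x).

Let derive_h (x : R) : is_derive x 1 h (- h x).
Proof.
have -> : h = c \*: (expR \o -%R) by [].
by apply: is_derive_eq; rewrite mulrN1 scalerN.
Qed.

Let ch : continuous h.
Proof.
by move=> x; apply: differentiable_continuous; apply/derivable1_diffP; case: (derive_h x).
Qed.

Let cvg_h : h x @[x --> +oo] --> (0 : R).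
Proof. by rewrite -[X in _ --> X](mulr0 c); apply: cvgMr; exact: cvgr_expR. Qed.

Let A (x : R) := (x ^+ 2 - v) * g x + h x.
(** An antiderivative of [A] that vanishes at infinity and equals [- c] at 0, so that [A] integrates
    to [c], as [h] does. *)
Let FA (x : R) := - (v * (x * g x)) - h x.

Let derive_FA (x : R) : is_derive x 1 FA (A x).
Proof.
have -> : FA = - (v \*: ((id : R -> R) * g)) - h by apply/funext.
have dg := derive_g x; have dh := derive_h x.
apply: is_derive_eq.
transitivity (- (v * (x * (- (s ^+ 2)^-1 * x * g x) + g x * 1)) - - h x) => //.
rewrite /A /v; field; exact: s_neq0.
Qed.

(** Only [x^2 < v] is delicate. There [x <= s], so [h x = v * normal_peak s * e^(s - x)] is at least
    [v * g x], which absorbs the negative part. *)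
Let A_ge0 x : 0 <= x -> 0 <= A x.
Proof.
move=> x0; have g0 : 0 <= g x by exact: normal_pdf_ge0.
have h0 : 0 <= h x by rewrite mulr_ge0// expR_ge0.
have [vx|xv] := leP v (x ^+ 2).
  by rewrite addr_ge0// mulr_ge0// subr_ge0.
have xs : x <= s by rewrite -(@ler_pXn2r _ 2) ?nnegrE ?(ltW s0)// (ltW xv).
have gp : g x <= normal_peak s by exact: normal_pdf_ub.
have vgh : v * g x <= h x.
  rewrite /h /c -mulrA -expRD -mulrA ler_wpM2l ?sqr_ge0//.
  apply: (le_trans gp); rewrite ler_peMr ?normal_peak_ge0//.
  by rewrite -expR0 ler_expR subr_ge0.
rewrite /A mulrBl addrAC -addrA addr_ge0 ?mulr_ge0 ?sqr_ge0//.
by rewrite subr_ge0.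
Qed.

Local Open Scope ereal_scope.

Let integral_A : \int[mu]_(x in `[0%R, +oo[) (A x)%:E = c%:E.
Proof.
rewrite (ge0_continuous_FTC2y (F := FA) (l := 0%R)).
- by rewrite /FA /h mul0r mulr0 oppr0 expR0 mulr1 sub0r EFinN oppeK add0e.
- exact: A_ge0.
- apply: continuous_subspaceT => x.
  apply: cvgD; last exact: ch.
  apply: cvgM; last exact: cg.
  by apply: cvgB; [exact: sqr_continuous|exact: cvg_cst].
- rewrite -[X in _ --> X](subr0 0%R) -{1}oppr0 -{1}(mulr0 v).
  apply: cvgB; last exact: cvg_h.
  by apply: cvgN; apply: cvgMr; exact: cvg_xg.
- by move=> x _; case: (derive_FA x).
- apply: cvg_at_right_filter; apply: differentiable_continuous.
  by apply/derivable1_diffP; case: (derive_FA 0).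
- by move=> x _; rewrite derive1E; exact: derive_val.
Qed.

Let integral_h : \int[mu]_(x in `[0%R, +oo[) (h x)%:E = c%:E.
Proof.
rewrite (ge0_continuous_FTC2y (F := (\- h)%R) (l := 0%R)).
- by rewrite /h /= oppr0 expR0 mulr1 -EFinD opprK add0r.
- by move=> x _; rewrite mulr_ge0// expR_ge0.
- exact: continuous_subspaceT.
- by rewrite -[X in _ --> X]oppr0; apply: cvgN; exact: cvg_h.
- by move=> x _; apply: derivableN; case: (derive_h x).
- by apply: cvg_at_right_filter; apply: cvgN; exact: ch.
- move=> x _; rewrite derive1E deriveN; last by case: (derive_h x).
  by have /@derive_val -> := derive_h x; rewrite opprK.
Qed.

Let integral_g : \int[mu]_(x in `[0%R, +oo[) (g x)%:E = 2^-1%:E.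
Proof.
have := @integral_normal_pdf R 0 s.
rewrite ge0_symfun_integralT//.
- rewrite -set_itvcy => /(congr1 (fun z => (2^-1)%:E * z)).
  by rewrite muleA -EFinM mulVf// mul1e mule1.
- by move=> x; exact: normal_pdf_ge0.
- by move=> x /=; rewrite -/g !gE sqrrN.
Qed.

(** Integrating [A x + v * g x = x ^+ 2 * g x + h x] gives [c + v / 2] on the left; the finite [c]
    contributed by [h] cancels. Every summand is nonnegative, so the integrals add. *)
Let integral_sqr : \int[mu]_(x in `[0%R, +oo[) (x ^+ 2 * g x)%:E = (v / 2)%:E.
Proof.
have mg : measurable_fun setT g by exact: measurable_normal_pdf.
have mh : measurable_fun setT h by exact: continuous_measurable_fun.
have mx2 : measurable_fun setT (fun x : R => x ^+ 2)%R by exact: measurable_funX.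
have mA : measurable_fun setT A.
  apply: measurable_funD => //; apply: measurable_funM => //.
  exact: measurable_funB.
have E1 : \int[mu]_(x in `[0%R, +oo[) (A x + v * g x)%:E = (c + v / 2)%:E.
  under eq_integral do rewrite EFinD.
  rewrite ge0_integralD//.
  - rewrite integral_A; under eq_integral do rewrite EFinM.
    rewrite ge0_integralZl ?integral_g// ?lee_fin ?sqr_ge0//.
    + exact/measurable_EFinP/measurable_funTS.
    + by move=> x _; rewrite lee_fin normal_pdf_ge0.
  - by move=> x /=; rewrite in_itv /= andbT lee_fin; exact: A_ge0.
  - exact/measurable_EFinP/measurable_funTS.
  - by move=> x _; rewrite lee_fin mulr_ge0 ?sqr_ge0 ?normal_pdf_ge0.
  - by apply/measurable_EFinP/measurable_funTS; exact: measurable_funM.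
have : \int[mu]_(x in `[0%R, +oo[) (x ^+ 2 * g x + h x)%:E = (c + v / 2)%:E.
  rewrite -E1; apply: eq_integral => x _; congr EFin.
  by rewrite /A; ring.
under eq_integral do rewrite EFinD.
rewrite ge0_integralD//=.
- rewrite integral_h => /(congr1 (fun z => z - c%:E)).
  by rewrite addeK// -EFinB addrAC subrr add0r.
- by move=> x _; rewrite lee_fin mulr_ge0 ?sqr_ge0 ?normal_pdf_ge0.
- apply/measurable_EFinP/measurable_funTS; exact: measurable_funM mx2 mg.
- by move=> x _; rewrite lee_fin mulr_ge0// expR_ge0.
- exact/measurable_EFinP/measurable_funTS.
Qed.

Lemma integral_sqr_normal_pdf :
  \int[mu]_x (x ^+ 2 * normal_pdf 0 s x)%:E = (s ^+ 2)%:E.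
Proof.
rewrite (@ge0_symfun_integralT _ (fun x => x ^+ 2 * g x)%R)//.
- by rewrite -set_itvcy integral_sqr -EFinM mulrC divfK.
- by move=> x; rewrite mulr_ge0 ?sqr_ge0 ?normal_pdf_ge0.
- by move=> x; apply: cvgM; [exact: sqr_continuous|exact: cg].
- by move=> x /=; rewrite sqrrN !gE sqrrN.
Qed.

End NormalSecondMoment.

(** The Radon-Nikodym derivative of the normal law and [normal_pdf] have the same integral over
    every measurable set, so they agree almost everywhere. *)
Lemma ge0_integral_normal_prob (R : realType) (m s : R) (f : R -> \bar R) :
  measurable_fun setT f -> (forall x, 0 <= f x)%E ->
  (\int[normal_prob m s]_x f x =
   \int[lebesgue_measure]_x (f x * (normal_pdf m s x)%:E))%E.
Proof.
move=> mf f0.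
have dom := @normal_prob_dominates R m s.
rewrite -(Radon_Nikodym_SigmaFinite.change_of_variables dom)//.
have ig := Radon_Nikodym_SigmaFinite.f_integrable dom.
have mp : measurable_fun setT (EFin \o normal_pdf m s).
  by apply/measurable_EFinP; exact: measurable_normal_pdf.
apply: ae_eq_integral => //.
- by apply: emeasurable_funM => //; exact: measurable_int ig.
- exact: emeasurable_funM.
- apply: ae_eqe_mul2l; apply: integral_ae_eq => // E _ mE.
  by rewrite -(Radon_Nikodym_SigmaFinite.f_integral dom).
Qed.

(** * Gaussian vectors and covariances *)

Section RealRandomVariables.
Context (dp : measure_display) (T : measurableType dp) (R : realType).
Variable P : probability T R.
Implicit Types (X Y Z : T -> R) (v : R).

Definition rcov X Y : R := fine (covariance P X Y).

Lemma L2_L1 X : X \in Lfun P 2%:E -> X \in Lfun P 1.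
Proof. by apply: Lfun_subset12; exact: fin_num_measure. Qed.

Lemma L2_measurable X : X \in Lfun P 2%:E -> measurable_fun setT X.
Proof. by rewrite inE => /andP[]; rewrite inE. Qed.

Lemma L2_add X Y : X \in Lfun P 2%:E -> Y \in Lfun P 2%:E ->
  X \+ Y \in Lfun P 2%:E.
Proof. by move=> X2 Y2; rewrite rpredD ?lee1n. Qed.

Lemma L2_sub X Y : X \in Lfun P 2%:E -> Y \in Lfun P 2%:E ->
  X \- Y \in Lfun P 2%:E.
Proof. by move=> X2 Y2; rewrite rpredB ?lee1n. Qed.

Lemma covariance_fin X Y : X \in Lfun P 2%:E -> Y \in Lfun P 2%:E ->
  covariance P X Y \is a fin_num.
Proof.
move=> X2 Y2; apply: covariance_fin_num (L2_L1 X2) (L2_L1 Y2) _.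
exact: Lfun2_mul_Lfun1.
Qed.

Lemma rcovC X Y : rcov X Y = rcov Y X.
Proof. by rewrite /rcov covarianceC. Qed.

Lemma rcovDl X Y Z : X \in Lfun P 2%:E -> Y \in Lfun P 2%:E ->
  Z \in Lfun P 2%:E -> rcov (X \+ Y) Z = rcov X Z + rcov Y Z.
Proof. by move=> ? ? ?; rewrite /rcov covarianceDl// fineD// covariance_fin. Qed.

Lemma rcovZl a X Z : X \in Lfun P 2%:E -> Z \in Lfun P 2%:E ->
  rcov (a \o* X) Z = a * rcov X Z.
Proof.
move=> X2 Z2; rewrite /rcov covarianceZl ?Lfun2_mul_Lfun1 ?L2_L1//.
by rewrite fineM// covariance_fin.
Qed.

Lemma L2_sqr_integral X : measurable_fun setT X ->
  (\int[P]_o (X o ^+ 2)%:E < +oo)%E -> X \in Lfun P 2%:E.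
Proof.
move=> mX X2; rewrite inE; apply/andP; split; rewrite inE//=.
rewrite /finite_norm unlock /= poweR_lty//.
rewrite (eq_integral (fun o => (X o ^+ 2)%:E))// => o _ /=.
by rewrite powR_mulrn ?normr_ge0// real_normK ?num_real.
Qed.

(** The integral is moved to the law of [X], a Dirac mass at 0 if [v = 0] and a normal law with
    density otherwise. *)
Lemma sqr_integral_normal_law v X : 0 <= v -> measurable_fun setT X ->
  (forall V, measurable V -> P [set o | V (X o)] = normal_law v V) ->
  (\int[P]_o (X o ^+ 2)%:E = v%:E)%E.
Proof.
move=> v0 mX lX.
have msq : measurable_fun setT (fun x : R => (x ^+ 2)%:E).
  by apply/measurable_EFinP; exact: measurable_funX.
(* normal_prob is a measure on measurableTypeR R, whose display is not that of R *)
pose Rm := measurableTypeR R.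
transitivity (\int[@pushforward _ _ T Rm R P X]_x (x ^+ 2)%:E)%E.
  by rewrite ge0_integral_pushforward// => x _; rewrite lee_fin sqr_ge0.
move: lX; rewrite /normal_law; have [->|vn0] := eqVneq v 0 => lX.
  rewrite (eq_measure_integral \d_(0 : Rm)) => [|A mA _]; last exact: lX.
  by rewrite integral_dirac// diracT mul1e expr0n.
have s0 : 0 < Num.sqrt v by rewrite sqrtr_gt0 lt0r vn0.
transitivity (\int[normal_prob 0 (Num.sqrt v)]_x (x ^+ 2)%:E)%E.
  by apply: eq_measure_integral => A mA _; exact: lX.
rewrite ge0_integral_normal_prob// => [|x]; last by rewrite lee_fin sqr_ge0.
under eq_integral do rewrite -EFinM.
by rewrite integral_sqr_normal_pdf// sqr_sqrtr.
Qed.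

Lemma expectation_eq_law X Y : X \in Lfun P 1 -> Y \in Lfun P 1 ->
  (forall V, measurable V -> P [set o | V (X o)] = P [set o | V (Y o)]) ->
  ('E_P[X] = 'E_P[Y])%E.
Proof.
move=> X1 Y1 XY.
have mE : measurable_fun [set: R] (@EFin R) by apply/measurable_EFinP; exact: measurable_id.
have [mX mY] : measurable_fun setT X /\ measurable_fun setT Y.
  by move: X1 Y1; rewrite !inE => /andP[+ _] /andP[+ _]; rewrite !inE.
rewrite unlock.
transitivity (\int[pushforward P X]_x x%:E)%E.
  by rewrite integral_pushforward//; exact/Lfun1_integrable.
rewrite (eq_measure_integral (pushforward P Y)) => [|A mA _]; last exact: XY.
by rewrite integral_pushforward//; exact/Lfun1_integrable.
Qed.

(** Independence says that the joint law agrees with the product of the marginal laws on rectangles,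
    hence everywhere; Fubini then factors the mean of the product. *)
Lemma covariance_independent X Y : X \in Lfun P 2%:E -> Y \in Lfun P 2%:E ->
  (forall A B, measurable A -> measurable B ->
     P (X @^-1` A `&` Y @^-1` B) = (P (X @^-1` A) * P (Y @^-1` B))%E) ->
  covariance P X Y = 0%E.
Proof.
move=> X2 Y2 XY; have [mX mY] := (L2_measurable X2, L2_measurable Y2).
have mX' : X \in mfun by rewrite inE.
have mY' : Y \in mfun by rewrite inE.
pose m1 : probability R R := distribution P (mfun_Sub mX').
pose m2 : probability R R := distribution P (mfun_Sub mY').
pose Z o := (X o, Y o).
have mZ : measurable_fun setT Z by exact: measurable_fun_pair.
have ZE E : measurable E -> (m1 \x m2)%E E = pushforward P Z E.
  by apply: product_measure_unique => A B mA mB; rewrite -XY.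
pose f (z : R * R) := (z.1 * z.2)%:E.
have mf : measurable_fun setT f.
  by apply/measurable_EFinP; apply: measurable_funM.
have iXY : P.-integrable setT (f \o Z).
  by apply/Lfun1_integrable; exact: Lfun2_mul_Lfun1.
rewrite covarianceE ?Lfun2_mul_Lfun1 ?L2_L1//.
suff -> : ('E_P[X * Y] = 'E_P[X] * 'E_P[Y])%E.
  by rewrite subee// fin_numM ?expectation_fin_num ?L2_L1.
have iZ : (m1 \x m2)%E.-integrable setT f.
  apply/integrableP; split=> //.
  rewrite (eq_measure_integral (pushforward P Z)) => [|A mA _]; last exact: ZE.
  by have /integrableP[] := integrable_pushforward mZ mf iXY measurableT.
rewrite unlock.
transitivity (\int[m1 \x m2]_z f z)%E.
  rewrite (eq_measure_integral (pushforward P Z)) => [|A mA _]; last exact: ZE.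
  by rewrite integral_pushforward.
rewrite -integral12_prod_meas1//.
have mE : measurable_fun [set: R] (@EFin R).
  by apply/measurable_EFinP; exact: measurable_id.
have iX : m1.-integrable setT (@EFin R).
  by apply: integrable_pushforward => //; exact/Lfun1_integrable/L2_L1.
have iY : m2.-integrable setT (@EFin R).
  by apply: integrable_pushforward => //; exact/Lfun1_integrable/L2_L1.
have EX : (\int[m1]_x x%:E = \int[P]_o (X o)%:E)%E.
  by rewrite integral_pushforward//; exact/Lfun1_integrable/L2_L1.
have EY : (\int[m2]_y y%:E = \int[P]_o (Y o)%:E)%E.
  by rewrite integral_pushforward//; exact/Lfun1_integrable/L2_L1.
(* A finite mean of [Y] is a real constant, which can be pulled out of the outer integral. *)
have EYfin : (\int[m2]_y y%:E \is a fin_num)%E by exact: integrable_fin_num.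
rewrite -EX -EY /fubini_F /f.
under eq_integral do under eq_integral do rewrite EFinM.
under eq_integral do rewrite integralZl//.
by rewrite -(fineK EYfin) integralZr.
Qed.

End RealRandomVariables.

Section RandomVectors.
Context (dp : measure_display) (T : measurableType dp) (R : realType).
Variable P : probability T R.

Definition L2_vec d (X : T -> 'cV[R]_d) :=
  forall i, rv_coord X i \in Lfun P 2%:E.

(** [ccov X X] is convertible to [covmx P X], which brings bilinearity to bear on covariance
    matrices. *)
Definition ccov d k (X : T -> 'cV[R]_d) (Y : T -> 'cV[R]_k) : 'M[R]_(d, k) :=
  \matrix_(i, j) rcov P (rv_coord X i) (rv_coord Y j).

Lemma ccov_tr d k (X : T -> 'cV[R]_d) (Y : T -> 'cV[R]_k) :
  (ccov X Y)^T = ccov Y X.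
Proof. by apply/matrixP => i j; rewrite !mxE rcovC. Qed.

(** Both claims go through one induction, since additivity of the covariance requires the partial
    sums to be square integrable. *)
Lemma lin_comb_rcov d (X : T -> 'cV[R]_d) (a : 'I_d -> R) (Z : T -> R) :
  L2_vec X -> Z \in Lfun P 2%:E ->
  (fun o => \sum_i a i * X o i 0) \in Lfun P 2%:E /\
  rcov P (fun o => \sum_i a i * X o i 0) Z = \sum_i a i * rcov P (rv_coord X i) Z.
Proof.
move=> X2 Z2; elim: (index_enum _) => [|i r [r2 rZ]].
  rewrite big_nil (_ : (fun o => _) = cst 0); last first.
    by apply/funext => o; rewrite big_nil.
  by rewrite /rcov covariance_cst_l; split=> //; exact: Lfun_cst.
rewrite big_cons (_ : (fun o => _) =
    (a i \o* rv_coord X i) \+ fun o => \sum_(i <- r) a i * X o i 0); last first.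
  by apply/funext => o; rewrite big_cons mulrC.
have aX2 : a i \o* rv_coord X i \in Lfun P 2%:E by apply: Lfun_scale; rewrite ?ler1n.
split; first exact: L2_add.
by rewrite rcovDl// rcovZl// rZ.
Qed.

Lemma mulmx_coord d k (M : 'M[R]_(k, d)) (X : T -> 'cV[R]_d) i :
  rv_coord (fun o => M *m X o) i = fun o => \sum_j M i j * X o j 0.
Proof. by apply/funext => o; rewrite /rv_coord mxE. Qed.

Lemma L2_vec_mul d k (M : 'M[R]_(k, d)) (X : T -> 'cV[R]_d) :
  L2_vec X -> L2_vec (fun o => M *m X o).
Proof.
move=> X2 i; rewrite mulmx_coord.
(* The constant 0 fills the place of [Z]. *)
by have [] := lin_comb_rcov (M i) X2 (Lfun_cst P 0 2).
Qed.

Lemma L2_vec_sub d (X Y : T -> 'cV[R]_d) :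
  L2_vec X -> L2_vec Y -> L2_vec (fun o => X o - Y o).
Proof.
move=> X2 Y2 i; rewrite (_ : rv_coord _ i = rv_coord X i \- rv_coord Y i).
  exact: L2_sub.
by apply/funext => o; rewrite /rv_coord !mxE.
Qed.

Lemma ccov_mul d k l (M : 'M[R]_(k, d)) (X : T -> 'cV[R]_d)
    (Y : T -> 'cV[R]_l) : L2_vec X -> L2_vec Y ->
  ccov (fun o => M *m X o) Y = M *m ccov X Y.
Proof.
move=> X2 Y2; apply/matrixP => i j; rewrite [LHS]mxE mulmx_coord.
rewrite (proj2 (lin_comb_rcov (M i) X2 (Y2 j))) mxE.
by apply: eq_bigr => m _; rewrite mxE.
Qed.

Lemma ccov_sub d l (X Y : T -> 'cV[R]_d) (Z : T -> 'cV[R]_l) :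
  L2_vec X -> L2_vec Y -> L2_vec Z ->
  ccov (fun o => X o - Y o) Z = ccov X Z - ccov Y Z.
Proof.
move=> X2 Y2 Z2; apply/matrixP => i j; rewrite !mxE.
rewrite (_ : rv_coord _ i = rv_coord X i \- rv_coord Y i).
  by rewrite /rcov covarianceBl// fineB// covariance_fin.
by apply/funext => o; rewrite /rv_coord !mxE.
Qed.

(** Linearity in the second argument comes from that in the first by transposition; the cross terms
    vanish. *)
Lemma ccov_lin2 d (M L : 'M[R]_d) (X Y : T -> 'cV[R]_d) :
  L2_vec X -> L2_vec Y -> ccov X Y = 0 ->
  covmx P (fun o => M *m X o - L *m Y o) =
  M *m covmx P X *m M^T + L *m covmx P Y *m L^T.
Proof.
move=> X2 Y2 XY; have YX : ccov Y X = 0 by rewrite -ccov_tr XY trmx0.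
pose Z o := M *m X o - L *m Y o.
have Z2 : L2_vec Z by apply: L2_vec_sub; exact: L2_vec_mul.
have lin V : L2_vec V -> ccov Z V = M *m ccov X V - L *m ccov Y V.
  by move=> V2; rewrite ccov_sub ?ccov_mul//; exact: L2_vec_mul.
rewrite -[LHS]/(ccov Z Z) lin// -(ccov_tr Z X) -(ccov_tr Z Y) !lin//.
rewrite XY YX !mulmx0 subr0 sub0r linearN /= mulmxN opprK !trmx_mul.
by rewrite !ccov_tr !mulmxA.
Qed.

Lemma gaussian_measurable d (X : T -> 'cV[R]_d) S (a : 'cV[R]_d) :
  gaussian P X S -> measurable_fun setT (fun o => (a^T *m X o) 0 0).
Proof.
move=> [_ mX _]; rewrite (_ : (fun o => _) = fun o => \sum_j a j 0 * X o j 0).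
  by apply: measurable_sum => j; apply: measurable_funM => //; exact: mX.
by apply/funext => o; rewrite mxE; apply: eq_bigr => j _; rewrite mxE.
Qed.

Lemma gaussian_sqr_integral d (X : T -> 'cV[R]_d) S (a : 'cV[R]_d) :
  gaussian P X S ->
  (\int[P]_o ((a^T *m X o) 0 0 ^+ 2)%:E = ((a^T *m S *m a) 0 0)%:E)%E.
Proof.
move=> gX; have mX := gaussian_measurable a gX; case: gX => [[_ pS] _ lX].
exact: (sqr_integral_normal_law (pS a) mX (lX a)).
Qed.

Lemma gaussian_L2 d (X : T -> 'cV[R]_d) S (a : 'cV[R]_d) :
  gaussian P X S -> (fun o => (a^T *m X o) 0 0) \in Lfun P 2%:E.
Proof.
move=> gX; apply: L2_sqr_integral; first exact: gaussian_measurable gX.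
by rewrite (gaussian_sqr_integral a gX) ltry.
Qed.

Lemma gaussian_coord d (X : T -> 'cV[R]_d) i :
  rv_coord X i = fun o => ((delta_mx i 0 : 'cV[R]_d)^T *m X o) 0 0.
Proof. by apply/funext => o; rewrite trmx_delta -rowE mxE. Qed.

Lemma gaussian_L2_vec d (X : T -> 'cV[R]_d) S : gaussian P X S -> L2_vec X.
Proof. by move=> gX i; rewrite gaussian_coord; exact: gaussian_L2 gX. Qed.

(* X and -X have the same law. *)
Lemma gaussian_centered d (X : T -> 'cV[R]_d) S (a : 'cV[R]_d) :
  gaussian P X S -> ('E_P[fun o => (a^T *m X o)%R 0%R 0%R] = 0)%E.
Proof.
move=> gX; have X2 b := gaussian_L2 b gX.
set f := fun o => _.
have fN : (fun o => ((- a)^T *m X o) 0 0) = -1 \o* f.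
  by apply/funext => o; rewrite /f /= linearN /= mulNmx mxE mulrN1.
have : ('E_P[f] = 'E_P[-1 \o* f])%E.
  rewrite -fN; apply: expectation_eq_law; rewrite ?L2_L1 ?X2// => V mV.
  case: gX => _ _ lX; rewrite [LHS](lX a V mV) [RHS](lX (- a) V mV).
  have -> : (- a)^T = - a^T by apply/matrixP => i j; rewrite !mxE.
  by rewrite mulmxN !mulNmx opprK.
rewrite expectationZl ?L2_L1 ?X2//.
(* A mean equal to its own opposite is 0 because it is finite. *)
have := expectation_fin_num (L2_L1 (X2 a)); rewrite -/f.
by case: ('E_P[f])%E => // r _ [H]; congr EFin; lra.
Qed.

Lemma gaussian_variance d (X : T -> 'cV[R]_d) S (a : 'cV[R]_d) :
  gaussian P X S ->
  let f := fun o => (a^T *m X o) 0 0 in rcov P f f = (a^T *m S *m a) 0 0.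
Proof.
move=> gX f; rewrite /rcov -[covariance P f f]/(variance P f).
rewrite varianceE ?(gaussian_L2 a gX)// (gaussian_centered a gX) expe2 mule0 sube0.
by rewrite unlock (gaussian_sqr_integral a gX).
Qed.

(** Polarization: the definition gives the law of one linear form at a time, so the off-diagonal
    entries are read off the variance of the sum of two coordinates. *)
Lemma gaussian_covmx d (X : T -> 'cV[R]_d) S : gaussian P X S -> covmx P X = S.
Proof.
move=> gX; apply/matrixP => i j; rewrite mxE -/(rcov P _ _).
have X2 := gaussian_L2_vec gX.
pose e k : 'cV[R]_d := delta_mx k 0.
have eSe k l : ((e k)^T *m S *m e l) 0 0 = S k l.
  by rewrite /e trmx_delta -rowE -colE !mxE.
have vii k : rcov P (rv_coord X k) (rv_coord X k) = S k k.
  by rewrite !gaussian_coord (gaussian_variance (e k) gX) eSe.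
have := gaussian_variance (e i + e j) gX; rewrite /=.
have -> : (fun o => ((e i + e j)^T *m X o) 0 0) = rv_coord X i \+ rv_coord X j.
  apply/funext => o; rewrite !gaussian_coord linearD /= mulmxDl.
  by rewrite mxE.
rewrite rcovDl ?(rcovC _ _ (_ \+ _)) ?L2_add// !rcovDl// !vii.
rewrite (rcovC _ (rv_coord X j)).
have -> : (e i + e j)^T = (e i)^T + (e j)^T by exact: linearD.
rewrite !mulmxDl !mulmxDr.
have addE (A B : 'M[R]_1) : (A + B) 0 0 = A 0 0 + B 0 0 by rewrite mxE.
rewrite !addE !eSe; case: gX => [[sS _] _ _].
have -> : S j i = S i j by rewrite -{1}sS mxE.
by move=> H; lra.
Qed.

Lemma independent_ccov0 (I : choiceType) d (X : I -> T -> 'cV[R]_d) i j :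
  mutually_independent P X -> i != j -> L2_vec (X i) -> L2_vec (X j) ->
  ccov (X i) (X j) = 0.
Proof.
move=> iX ij Xi2 Xj2; apply/matrixP => k l; rewrite !mxE /rcov.
rewrite covariance_independent// => A B mA mB.
(* Only the indices [i] and [j] are tested, and [i != j] keeps the two events apart. *)
pose E m := if m == i then rv_coord (X i) k @^-1` A else rv_coord (X j) l @^-1` B.
have Ei : E i = rv_coord (X i) k @^-1` A by rewrite /E eqxx.
have Ej : E j = rv_coord (X j) l @^-1` B by rewrite /E eq_sym (negbTE ij).
have := iX [:: i; j] E; rewrite /= !inE ij => /(_ isT).
rewrite !big_cons big_nil mule1 Ei Ej => iE; rewrite -iE.
  congr (P _); apply/seteqP; split=> [u [uA uB] m|u uAB] /=.
    by rewrite !inE => /orP[] /eqP ->; rewrite ?Ei ?Ej.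
  split; [move: (uAB i)|move: (uAB j)]; rewrite ?Ei ?Ej; apply.
    by rewrite /= mem_head.
  by rewrite /= inE mem_seq1 eqxx orbT.
move=> m; rewrite !inE => /orP[] /eqP ->.
  by rewrite Ei; apply: sub_gen_smallest; exists k, A.
by rewrite Ej; apply: sub_gen_smallest; exists l, B.
Qed.

End RandomVectors.

(** * The error process of the scheme *)

Section ErrorDynamics.
Context (dp : measure_display) (T : measurableType dp) (R : realType).
Variables (P : probability T R) (n d0 d1 d2 : nat).
Variables (A : 'M[R]_d0) (B1 : 'M[R]_(d0, d1)) (B2 : 'M[R]_(d0, d2)).
Variables (W Sigma0 : 'M[R]_d0) (K D : nat -> 'M[R]_(d1 + d2, d0)).
Variables (Q : 'M[R]_(d1, d0)) (S : nat -> 'M[R]_d0).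
Variables (x0 xs : T -> 'cV[R]_d0) (w : nat -> T -> 'cV[R]_d0).
Variables (x : nat -> T -> 'cV[R]_d0).
Variables (v : nat -> T -> 'cV[R]_d1) (q : nat -> T -> 'cV[R]_d2).
Variables (s : nat -> T -> 'cV[R]_d1) (c : nat -> T -> 'cV[R]_(d1 + d2)).
Variables (y e ehat xhat : nat -> T -> 'cV[R]_d0).
Hypothesis hrun : implicit_coordination P n A B1 B2 W K D Q S x0 xs w
  x v q s c y e ehat xhat.

(** The updates of [e] and [xhat] are opposite. This links the covariance in the theorem to the one
    inside the scheme. *)
Lemma run_error t o : (t <= n)%N -> e t o = xs o - xhat t o.
Proof.
elim: t => [_|t ih tn]; first by rewrite (ic_e0 hrun) (ic_xhat0 hrun) subr0.
by rewrite (ic_e hrun o tn) (ic_xhat hrun o tn) (ih (ltnW tn)) opprD addrA.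
Qed.

(** The state feedback and the term in [c] enter [x t.+1] exactly as they are subtracted in [y t],
    leaving the leader's signal and the noise. *)
Lemma run_observation t o : (t < n)%N -> y t o = B1 *m s t o + w t o.
Proof.
move=> tn; rewrite (ic_y hrun o tn) (ic_x hrun o tn) (ic_v hrun o tn) (ic_q hrun o tn).
have -> : row_mx B1 B2 *m K t = B1 *m usubmx (K t) + B2 *m dsubmx (K t).
  by rewrite -{1}(vsubmxK (K t)) mul_row_col.
have -> : row_mx B1 B2 *m c t o = B1 *m usubmx (c t o) + B2 *m dsubmx (c t o).
  by rewrite -{1}(vsubmxK (c t o)) mul_row_col.
rewrite !mulmxBl !mulmxDl !mulmxDr !mulmxN -!mulmxA.
set a := A *m _; set b := B1 *m (_ *m _); set b' := B2 *m (_ *m _).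
set g := B1 *m usubmx _; set g' := B2 *m dsubmx _; set z := B1 *m s _ _.
by apply/matrixP => i j; rewrite !mxE; ring.
Qed.

Hypotheses (pW : pdmx W) (pSigma0 : pdmx Sigma0).
Hypothesis (pS : forall t, (t < n)%N -> pdmx (S t)).
Hypotheses (gxs : gaussian P xs Sigma0) (gw : forall t, gaussian P (w t) W).
Hypothesis indep : mutually_independent P (primitives x0 xs w).

(** [L t] is the gain taking [y t] to the estimate [ehat t]. [L] and [M] have the shape found in
    [posterior_covE]. *)
Let N t := (B1 *m Q) *m sqrtmx (S t).
Let Sig t := covmx P (e t).
Let G t := sqrtmx (Sig t).
Let L t := G t *m (N t)^T *m invmx (innovation_cov (B1 *m Q) W (S t)).
Let M t := 1%:M - L t *m N t *m invmx (G t).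

Lemma run_error_step t o : (t < n)%N -> e t.+1 o = M t *m e t o - L t *m w t o.
Proof.
move=> tn; rewrite (ic_e hrun o tn) (ic_ehat hrun o tn) (run_observation o tn).
rewrite (ic_s hrun o tn).
have [[sS _] S2] := sqrtmxP (pd_psd (pS tn)).
have -> : B1 *m Q *m S t *m Q^T *m B1^T + W = innovation_cov (B1 *m Q) W (S t).
  by rewrite /innovation_cov !trmx_mul sS -{1}S2 !mulmxA.
have -> : sqrtmx (covmx P (e t)) *m sqrtmx (S t) *m Q^T *m B1^T =
    G t *m (N t)^T by rewrite /N !trmx_mul sS !mulmxA.
rewrite -/(L t) mulmxDr /M mulmxBl mul1mx opprD addrA; congr (_ - _ - _).
by rewrite /N !mulmxA.
Qed.

(** The three claims support each other: square integrability gives bilinearity, the absence of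
    correlation with present and future noise removes the cross terms, and definiteness keeps [G t]
    invertible. *)
Lemma run_invariant t : (t <= n)%N ->
  [/\ L2_vec P (e t), pdmx (Sig t)
    & forall k, (t <= k)%N -> ccov P (e t) (w k) = 0].
Proof.
have w2 k : L2_vec P (w k) := gaussian_L2_vec (gw k).
have xs2 := gaussian_L2_vec gxs.
(* In [primitives] the target has index 1 and [w k] has index [k.+2]. *)
have ww k l : k != l -> ccov P (w k) (w l) = 0.
  by move=> kl; exact: (independent_ccov0 (i := k.+2) (j := l.+2) indep kl (w2 k) (w2 l)).
elim: t => [_|t ih tn].
  have e0 : e 0%N = xs by apply/funext => o; rewrite (ic_e0 hrun).
  rewrite /Sig e0 (gaussian_covmx gxs); split=> // k _.
  exact: (independent_ccov0 (i := 1%N) (j := k.+2) indep isT xs2 (w2 k)).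
have [e2 pSig ew] := ih (ltnW tn).
have eS : e t.+1 = fun o => M t *m e t o - L t *m w t o.
  by apply/funext => o; rewrite run_error_step.
have Me2 : L2_vec P (fun o => M t *m e t o) by exact: L2_vec_mul.
have Lw2 : L2_vec P (fun o => L t *m w t o) by exact: L2_vec_mul.
split.
- by rewrite eS; exact: L2_vec_sub.
- rewrite /Sig eS ccov_lin2 ?ew// (gaussian_covmx (gw t)) posterior_covE//.
  exact: posterior_cov_pd.
(* Here [t < k], so [w k] is uncorrelated with [e t] by induction and with [w t] by independence. *)
- move=> k tk; rewrite eS ccov_sub// !ccov_mul// ew ?(ltnW tk)// ww ?ltn_eqF//.
  by rewrite !mulmx0 subrr.
Qed.

Lemma run_error_cov_step t : (t < n)%N ->
  covmx P (e t.+1) = posterior_cov (B1 *m Q) W (S t) (covmx P (e t)).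
Proof.
move=> tn; have [e2 pSig ew] := run_invariant (ltnW tn).
rewrite (_ : e t.+1 = fun o => M t *m e t o - L t *m w t o); last first.
  by apply/funext => o; rewrite run_error_step.
rewrite ccov_lin2 ?ew//; last exact: gaussian_L2_vec (gw t).
by rewrite (gaussian_covmx (gw t)) posterior_covE//; exact: pS.
Qed.

End ErrorDynamics.

(** * Monotonicity of the error covariance and geometric decay of its trace *)

Theorem theorem1 (R : realType) (dp : measure_display) (T : measurableType dp)
  (P : probability T R) (n d0 d1 d2 : nat)
  (hd0 : (0 < d0)%N) (hd1 : (0 < d1)%N) (hd2 : (0 < d2)%N)
  (* system *)
  (A : 'M[R]_d0) (B1 : 'M[R]_(d0, d1)) (B2 : 'M[R]_(d0, d2))
  (W X0 Sigma0 : 'M[R]_d0)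
  (x0 xs : T -> 'cV[R]_d0) (w : nat -> T -> 'cV[R]_d0)
  (hAB : controllable A (row_mx B1 B2))
  (hW : pdmx W) (hSigma0 : pdmx Sigma0)
  (hx0 : gaussian P x0 X0) (hxs : gaussian P xs Sigma0)
  (hw : forall t, gaussian P (w t) W)
  (hindep : mutually_independent P (primitives x0 xs w))
  (* gains *)
  (F Fn : 'M[R]_d0) (G1 : 'M[R]_d1) (G2 : 'M[R]_d2)
  (hF : psdmx F) (hFn : psdmx Fn) (hG1 : psdmx G1) (hG2 : psdmx G2)
  (Phi Dbar : nat -> 'M[R]_d0) (K D : nat -> 'M[R]_(d1 + d2, d0))
  (hgains : gains n A (row_mx B1 B2) F Fn (block_mx G1 0 0 G2) Phi Dbar K D)
  (* power matrices *)
  (Q : 'M[R]_(d1, d0)) (U : 'M[R]_d0) (H : 'rV[R]_d0)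
  (hU : U *m U^T = 1%:M)
  (hH : (B1 *m Q)^T *m invmx W *m (B1 *m Q) = U *m diag_mx H *m U^T)
  (S : nat -> 'M[R]_d0) (Lambda : nat -> 'rV[R]_d0)
  (hSpd : forall t, (t < n)%N -> pdmx (S t))
  (hS : forall t, (t < n)%N -> S t = U *m diag_mx (Lambda t) *m U^T)
  (* run of the scheme *)
  (x : nat -> T -> 'cV[R]_d0)
  (v : nat -> T -> 'cV[R]_d1) (q : nat -> T -> 'cV[R]_d2)
  (s : nat -> T -> 'cV[R]_d1) (c : nat -> T -> 'cV[R]_(d1 + d2))
  (y e ehat xhat : nat -> T -> 'cV[R]_d0)
  (hrun : implicit_coordination P n A B1 B2 W K D Q S x0 xs w
            x v q s c y e ehat xhat)
  (sigma : R) (hsigma : 0 < sigma)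
  (hLambda : forall t (i : 'I_d0), (t < n)%N -> sigma <= Lambda t 0 i) :
  let Sigma t := covmx P (fun o => xs o - xhat t o) in
  (forall t, (1 <= t)%N -> (t < n)%N -> loewner_ge (Sigma t) (Sigma t.+1)) /\
  (\rank (B1 *m Q) = \rank B1 -> \rank B1 = d0 ->
     (forall t, (1 <= t)%N -> (t < n)%N ->
        loewner_gt (Sigma t) (Sigma t.+1)) /\
     (forall t, (1 <= t)%N -> (t <= n)%N ->
        \tr (Sigma t) <=
        1 / (1 + sigma * min_entry hd0 H) ^+ t * \tr (Sigma 0%N))).
Proof.
move=> Sigma.
have inv := run_invariant hrun hW hSigma0 hSpd hxs hw hindep.
have SigmaE t : (t <= n)%N -> Sigma t = covmx P (e t).
  move=> tn; rewrite /Sigma; congr covmx.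
  by apply/funext => o; rewrite (run_error hrun).
have pSig t : (t <= n)%N -> pdmx (Sigma t).
  by move=> tn; rewrite SigmaE//; have [] := inv t tn.
have stepE t : (t < n)%N ->
    Sigma t.+1 = posterior_cov (B1 *m Q) W (S t) (Sigma t).
  move=> tn; rewrite !SigmaE ?(ltnW tn)//.
  exact: (run_error_cov_step hrun hW hSigma0 hSpd hxs hw hindep).
split=> [t _ tn|rBQ rB].
  rewrite /loewner_ge stepE//.
  by apply: sub_posterior_cov_psd => //; exact/pSig/ltnW.
have uBQ : B1 *m Q \in unitmx by rewrite -row_free_unit /row_free rBQ rB.
split=> [t _ tn|t _].
  rewrite /loewner_gt stepE//.
  by apply: sub_posterior_cov_pd => //; [exact: hSpd|exact/pSig/ltnW].
set psi := min_entry hd0 H; set k := 1 + sigma * psi.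
(* The entry [H 0 i] is the value at the [i]-th column of [U] of the positive semi-definite form
   that [U] diagonalises. *)
have H_ge0 i : 0 <= H 0 i.
  pose a : 'cV[R]_d0 := delta_mx i 0; have UU : U^T *m U = 1%:M by exact: mulmx1C.
  have [_ /(_ (U *m a))] := psd_congr (B1 *m Q) (pd_psd (pd_inv hW)).
  have -> : (U *m a)^T *m ((B1 *m Q)^T *m invmx W *m (B1 *m Q)) *m (U *m a)
      = a^T *m diag_mx H *m a.
    by rewrite hH trmx_mul -!mulmxA !(mulmxA U^T U) UU !mul1mx.
  by rewrite form_delta mxE eqxx.
have psi0 : 0 <= psi by exact: min_entry_ge0.
have k0 : 0 < k by rewrite ltr_pwDl// mulr_ge0// ltW.
(* Cleared of the denominator, the bound follows by induction from 0, each step contributing one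
   factor [k]. *)
suff le_tr : (t <= n)%N -> k ^+ t * \tr (Sigma t) <= \tr (Sigma 0%N).
  by move=> tn; rewrite mul1r ler_pdivlMl ?exprn_gt0// le_tr.
elim: t => [_|t ih tn]; first by rewrite expr0 mul1r.
apply: le_trans (ih (ltnW tn)); rewrite exprSr -mulrA.
apply: ler_wpM2l; first by rewrite exprn_ge0// ltW.
rewrite stepE//; apply: tr_posterior_cov_le => // [|b]; first exact/pSig/ltnW.
apply: (posterior_factor_le hW (hSpd t tn) b hU hH (hS t tn)) => //.
- exact: ltW.
- by move=> i; exact: hLambda.
- exact: min_entry_le.
Qed.
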